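(* Let $q$ be a prime power and let $\ell$ be a positive integer; put $\tau=\ell-1$. Let $\mathcal{E}$ be the type II group (prescribing $\ell$ leading coefficients), written as an internal direct product of cyclic groups with generators $\xi_1,\dots,\xi_f$ of orders $r_1,\dots,r_f$, and let $\omega_{r_i}=\exp(2\pi\sqrt{-1}/r_i)$ for $1\le i\le f$. For $\vec j\in\mathcal{J}$ let $P_{\vec j}(z)=1+\sum_{k=1}^{\tau}c_{k,\vec j}z^k$, and let $\mathcal{S}_{\vec j}$ be the multiset of all complex roots of $P_{\vec j}(z)$. Then for every $d\ge1$ the number $I_d(\vec t)$ of monic irreducible polynomials of degree $d$ over $\mathbb{F}_q$ whose $\ell$ leading coefficients are those prescribed by the class $\varepsilon=\xi_1^{t_1}\cdots\xi_f^{t_f}$ is $$I_d(\vec t)=\frac1d\sum_{k\mid d}\mu(k)\sum_{\vec s\in\mathcal{R}}N_{d/k}(\vec s)\,\left[\!\left[k\vec s\equiv\vec t\pmod{\vec r}\right]\!\right],$$ where, for $n\ge1$ and every exponent vector $\vec t$, $$N_n(\vec t)=q^{n-\ell}+q^{-\ell}\sum_{\vec j\in\mathcal{J}}\prod_{i=1}^f\omega_{r_i}^{-j_it_i}\;n[z^n]\ln P_{\vec j}(z) =q^{n-\ell}-q^{-\ell}\sum_{\vec j\in\mathcal{J}}\prod_{i=1}^f\omega_{r_i}^{-j_it_i}\sum_{\rho\in\mathcal{S}_{\vec j}}\rho^{-n}.$$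
   Context: $\mathcal{M}$ is the set of monic polynomials over $\mathbb{F}_q$ (including the constant $1$), $\mathcal{M}_d$ those of degree $d$; the reciprocal of $f$ is $\tilde f(x)=x^{\deg f}f(1/x)$. Type II equivalence: monic $f,g$ are equivalent if $\tilde f\equiv\tilde g\pmod{x^{\ell+1}}$ (i.e. they have the same $\ell$ leading coefficients after the leading 1, missing coefficients being read as $0$). $\mathcal{E}$ is the set of equivalence classes $\langle f\rangle$ of monic $f$; it is a finite abelian group of order $q^\ell$ under $\langle f\rangle\langle g\rangle=\langle fg\rangle$. $I_d(\vec t)=I_d(\varepsilon)=\#\{f\in\mathcal{M}_d: f\text{ irreducible},\ \langle f\rangle=\varepsilon\}$ for $\varepsilon=\prod_i\xi_i^{t_i}$. $N_n(\vec t)=N_n(\varepsilon):=n[z^n\varepsilon]\ln F(z)$ for $\varepsilon=\prod_i\xi_i^{t_i}$, where $F(z)=\sum_{f\in\mathcal{M}}\langle f\rangle z^{\deg f}\in\mathbb{C}\mathcal{E}[[z]]$ and $[z^n\varepsilon]$ extracts the coefficient of $z^n\varepsilon$. $\mathcal{E}$ is the internal direct product of the cyclic groups $C_{r_i}=\langle\xi_i\rangle$ of order $r_i$. With $[n]=\{1,\dots,n\}$: $\mathcal{R}=[r_1]\times\cdots\times[r_f]$, $\vec r=(r_1,\dots,r_f)$, $\mathcal{J}=\mathcal{R}\setminus\{\vec r\}$. The condition $k\vec s\equiv\vec t\pmod{\vec r}$ means $ks_i\equiv t_i\pmod{r_i}$ for all $i$; $[\![\cdot]\!]$ is the Iverson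 bracket (1 if true, 0 if false); $\mu$ is the Möbius function. For $1\le d\le\tau$, $\mathcal{E}_d=\{\langle f\rangle:f\in\mathcal{M}_d\}$, and for $\vec j\in\mathcal{R}$, $c_{d,\vec j}=\sum_{\varepsilon\in\mathcal{E}_d}\prod_{i=1}^f\omega_{r_i}^{v_ij_i}$ where $\varepsilon=\prod_{i=1}^f\xi_i^{v_i}$. *)

(* Defs.v *)
From HB Require Import structures.
From mathcomp Require Import all_boot all_order all_algebra all_fingroup all_field.
From mathcomp Require Import zify generic_quotient complex.
From mathcomp Require Import reals trigo.

Set Implicit Arguments.
Unset Strict Implicit.
Unset Printing Implicit Defensive.

Import GRing.Theory.
Local Open Scope quotient_scope.
Local Open Scope complex_scope.
Local Open Scope ring_scope.

Section Reciprocal.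
Variable F : fieldType.
Implicit Types p q : {poly F}.

(* x^n p(1/x), for p of degree at most n *)
Definition revpoly n p : {poly F} := \poly_(i < n.+1) p`_(n - i).

Definition reciprocal p : {poly F} := revpoly (size p).-1 p.

Lemma coef_revpoly n p i : (revpoly n p)`_i = if (i <= n)%N then p`_(n - i) else 0.
Proof. by rewrite coef_poly ltnS. Qed.

Lemma revpolyE n p : revpoly n p = \sum_(i < n.+1) p`_i *: 'X^(n - i).
Proof.
rewrite /revpoly poly_def (reindex_inj rev_ord_inj) /=.
by apply: eq_bigr => i _; rewrite subSS subKn // -ltnS.
Qed.

Lemma revpolyM m n p q : (size p <= m.+1)%N -> (size q <= n.+1)%N ->
  revpoly (m + n) (p * q) = revpoly m p * revpoly n q.
Proof.
move=> sp sq; apply/polyP=> k; rewrite coef_revpoly.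
have {1}-> : p * q =
    \sum_(i < m.+1) \sum_(j < n.+1) (p`_i * q`_j) *: 'X^(i + j).
  rewrite -{1}(coefK p) -{1}(coefK q).
  have polyw r N : (size r <= N)%N -> \poly_(i < size r) r`_i
     = \sum_(i < N) r`_i *: 'X^i :> {poly F}.
    move=> sr; rewrite -poly_def; apply/polyP=> i; rewrite !coef_poly.
    case: ltnP => ir; first by rewrite (leq_trans ir sr).
    by rewrite nth_default // if_same.
  rewrite (polyw _ _ sp) (polyw _ _ sq) mulr_suml; apply: eq_bigr => i _.
  rewrite mulr_sumr; apply: eq_bigr => j _.
  by rewrite -scalerAl -scalerAr scalerA exprD.
rewrite !revpolyE mulr_suml !coef_sum.
case: leqP => kmn.
  apply: eq_bigr => i _; rewrite mulr_sumr !coef_sum; apply: eq_bigr => j _.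
  rewrite -scalerAl -scalerAr scalerA -exprD !coefZ !coefXn; congr (_ * _%:R).
  have := ltn_ord i; have := ltn_ord j; rewrite !ltnS => jn im.
  by congr nat_of_bool; apply/eqP/eqP; lia.
rewrite big1 // => i _; rewrite mulr_sumr coef_sum big1 // => j _.
rewrite -scalerAl -scalerAr scalerA -exprD coefZ coefXn.
case: eqP => [kE|_]; last by rewrite mulr0.
by move: kmn; rewrite kE ltnNge leq_add // leq_subr.
Qed.

Lemma reciprocalM p q : p \is monic -> q \is monic ->
  reciprocal (p * q) = reciprocal p * reciprocal q.
Proof.
move=> /monic_neq0 p0 /monic_neq0 q0; rewrite /reciprocal size_mul //.
rewrite -revpolyM ?leqSpred //; congr revpoly.
move: p0 q0; rewrite -!size_poly_gt0.
by case: (size p) => // a; case: (size q) => // b _ _; rewrite addnS.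
Qed.

Lemma reciprocal_coef0 p : p \is monic -> (reciprocal p)`_0 = 1.
Proof. by move=> mp; rewrite coef_revpoly subn0; apply/eqP. Qed.

Lemma coprime_reciprocal n p : p \is monic -> coprimep 'X^n (reciprocal p).
Proof.
move=> mp; apply: coprimep_expl; rewrite coprimep_sym -[ 'X]subr0 coprimep_XsubC.
by rewrite rootE horner_coef0 reciprocal_coef0 // oner_eq0.
Qed.

Lemma reciprocal_revpoly n p : p`_0 = 1 ->
  (revpoly n p \is monic) /\ reciprocal (revpoly n p) = take_poly n.+1 p.
Proof.
move=> p0; have sz : size (revpoly n p) = n.+1.
  by rewrite size_poly_eq // subnn p0 oner_eq0.
split; first by rewrite monicE lead_coefE sz coef_revpoly leqnn subnn p0.
apply/polyP=> i; rewrite /reciprocal sz coef_revpoly coef_take_poly ltnS.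
by case: leqP => // lin; rewrite coef_revpoly leq_subr subKn.
Qed.
End Reciprocal.

Section TypeII.
Variables (F : finFieldType) (l : nat).

(* The quotient of the monic polynomials by congruence of the reciprocals modulo
   x^(l+1), made into a group by <p><q> = <pq>.  The inverse comes from
   cancellation in a finite monoid; finiteness is witnessed by the
   coefficients of the reciprocal up to degree l. *)
Definition monicpoly := {p : {poly F} | p \is monic}.

Definition equivII (p q : monicpoly) :=
  reciprocal (val p) %% 'X^(l.+1) == reciprocal (val q) %% 'X^(l.+1).

Fact equivII_refl : reflexive equivII. Proof. by move=> p; apply: eqxx. Qed.
Fact equivII_sym : symmetric equivII. Proof. by move=> p q; apply: eq_sym. Qed.
Fact equivII_trans : transitive equivII.
Proof. by rewrite /equivII => q p r /eqP->. Qed.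

Canonical equivII_equiv := EquivRel equivII equivII_refl equivII_sym equivII_trans.

Definition typeII := {eq_quot equivII}.
HB.instance Definition _ : EqQuotient _ equivII typeII := EqQuotient.on typeII.
HB.instance Definition _ := Choice.on typeII.

Definition monic1 : monicpoly := exist _ 1 (monic1 F).
Fact monicM_subproof (p q : monicpoly) : val p * val q \is monic.
Proof. by rewrite monicMl; [exact: (valP q)|exact: (valP p)]. Qed.
Definition monicM (p q : monicpoly) : monicpoly :=
  exist _ (val p * val q) (monicM_subproof p q).

Lemma equivIIM p q r : equivII (monicM p r) (monicM q r) = equivII p q.
Proof.
rewrite /equivII /= !reciprocalM ?(valP p, valP q, valP r) //.
have eqE (a b d : {poly F}) : (a %% d == b %% d) = (d %| a - b).
  by rewrite /dvdp modpD modpN subr_eq0.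
rewrite !eqE -mulrBl Gauss_dvdpl //; exact: coprime_reciprocal (valP r).
Qed.

Definition typeII_mul (x y : typeII) : typeII := \pi_typeII (monicM (repr x) (repr y)).

Lemma monicMC : commutative monicM.
Proof. by move=> p q; apply: val_inj; rewrite /= mulrC. Qed.

Lemma pi_monicM p q :
  \pi_typeII (monicM p q) = typeII_mul (\pi_typeII p) (\pi_typeII q).
Proof.
apply/eqmodP; apply: (@equivII_trans (monicM (repr (\pi_typeII p)) q)).
  by rewrite /= equivIIM; apply/eqmodP; rewrite reprK.
rewrite /= monicMC [monicM (repr _) _]monicMC equivIIM.
by apply/eqmodP; rewrite reprK.
Qed.

Definition typeII_decode (s : {poly_(l.+1) F}) : typeII :=
  \pi_typeII (insubd monic1 (revpoly l (val s))).
Definition typeII_code (x : typeII) : {poly_(l.+1) F} :=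
  npolyp l.+1 (take_poly l.+1 (reciprocal (val (repr x)))).

Lemma typeII_codeK : cancel typeII_code typeII_decode.
Proof.
move=> x; rewrite -[RHS]reprK; apply/eqmodP; rewrite /= /equivII.
pose p := repr x; pose s := take_poly l.+1 (reciprocal (val p)).
have s0 : s`_0 = 1 by rewrite coef_take_poly reciprocal_coef0 ?(valP p).
have [ms rs] := reciprocal_revpoly l s0.
rewrite /typeII_code -/p -/s /= npolypK ?size_take_poly // insubdK //.
rewrite rs -!Pdiv.IdomainMonic.take_poly_modp (@take_poly_id _ _ s) ?size_take_poly //.
by rewrite take_poly_id ?size_take_poly.
Qed.

HB.instance Definition _ := Countable.copy typeII (can_type typeII_codeK).
HB.instance Definition _ : isFinite typeII := CanIsFinite typeII_codeK.

Definition typeII_one : typeII := \pi_typeII monic1.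

Fact typeII_mulA : associative typeII_mul.
Proof.
elim/quotW=> p; elim/quotW=> q; elim/quotW=> r.
rewrite -(pi_monicM q) -(pi_monicM p q) -(pi_monicM p) -(pi_monicM _ r).
by congr (\pi_typeII _); apply: val_inj; rewrite /= mulrA.
Qed.
Fact typeII_mul1g : left_id typeII_one typeII_mul.
Proof.
elim/quotW=> p; rewrite -pi_monicM; congr (\pi_typeII _).
by apply: val_inj; rewrite /= mul1r.
Qed.
Fact typeII_mulI x : injective (typeII_mul^~ x).
Proof.
elim/quotW: x => p; elim/quotW=> q; elim/quotW=> r; rewrite -!pi_monicM.
by move/eqmodP; rewrite /= equivIIM => ?; apply/eqmodP.
Qed.

Definition typeII_inv x : typeII := @invF typeII _ (@typeII_mulI x) typeII_one.
Fact typeII_mulVg : left_inverse typeII_one typeII_inv typeII_mul.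
Proof. by move=> x; exact: (@f_invF typeII _ (@typeII_mulI x)). Qed.

HB.instance Definition _ :=
  Finite_isGroup.Build typeII typeII_mulA typeII_mul1g typeII_mulVg.

(* The class <p>; only meaningful for p monic (otherwise it is <1>) *)
Definition cls (p : {poly F}) : typeII := \pi_typeII (insubd monic1 p).

Lemma cls1 : cls 1 = 1%g.
Proof. by congr (\pi_typeII _); apply: val_inj; rewrite /= insubdK // rpred1. Qed.

Lemma clsM p q : p \is monic -> q \is monic -> cls (p * q) = (cls p * cls q)%g.
Proof.
move=> mp mq; rewrite -[RHS]pi_monicM; congr (\pi_typeII _); apply: val_inj.
by rewrite /= !insubdK // unfold_in ?monicMl.
Qed.

Lemma typeII_abelian : abelian [set: typeII].
Proof.
apply/centsP=> x _ y _; move: x y; elim/quotW=> p; elim/quotW=> q.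
by rewrite /commute -[LHS]pi_monicM -[RHS]pi_monicM monicMC.
Qed.

Lemma eq_cls p q : p \is monic -> q \is monic ->
  (cls p == cls q) = (reciprocal p %% 'X^(l.+1) == reciprocal q %% 'X^(l.+1)).
Proof. by move=> mp mq; rewrite eqmodE /= /equivII !insubdK. Qed.
End TypeII.

Section GroupAlgebra.
Variables (K : nzRingType) (G : finGroupType).

(* The convolution algebra K[G]: the function u stands for sum_g u(g) g *)
Definition galg := {ffun G -> K^o}.
HB.instance Definition _ := GRing.Lmodule.copy galg {ffun G -> K^o}.
Implicit Types u v w : galg.

Definition galg_delta (g : G) : galg := [ffun x => (x == g)%:R].
Definition galg_mul u v : galg := [ffun g => \sum_x u x * v (x^-1 * g)%g].

Fact galg_mulA : associative galg_mul.
Proof.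
move=> u v w; apply/ffunP=> g; rewrite !ffunE.
under [RHS]eq_bigr => x _ do rewrite ffunE mulr_suml.
rewrite exchange_big /=; apply: eq_bigr => y _.
rewrite ffunE mulr_sumr [RHS](reindex_inj (mulgI y)) /=.
by apply: eq_bigr => x _; rewrite mulKg invMg mulgA mulrA.
Qed.
Fact galg_mul1r : left_id (galg_delta 1%g) galg_mul.
Proof.
move=> u; apply/ffunP=> g; rewrite ffunE (bigD1 1%g) //= ffunE eqxx mul1r.
rewrite invg1 mul1g big1 ?addr0 // => x /negPf x1.
by rewrite ffunE x1 mul0r.
Qed.
Fact galg_mulr1 : right_id (galg_delta 1%g) galg_mul.
Proof.
move=> u; apply/ffunP=> g; rewrite ffunE (bigD1 g) //= ffunE mulVg eqxx mulr1.
rewrite big1 ?addr0 // => x /negPf xg.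
by rewrite ffunE -eq_mulVg1 xg mulr0.
Qed.
Fact galg_mulDl : left_distributive galg_mul +%R.
Proof.
move=> u v w; apply/ffunP=> g; rewrite !ffunE -big_split /=.
by apply: eq_bigr => x _; rewrite ffunE mulrDl.
Qed.
Fact galg_mulDr : right_distributive galg_mul +%R.
Proof.
move=> u v w; apply/ffunP=> g; rewrite !ffunE -big_split /=.
by apply: eq_bigr => x _; rewrite ffunE mulrDr.
Qed.
Fact galg_1neq0 : galg_delta 1%g != 0.
Proof.
by apply/eqP=> /ffunP/(_ 1%g)/eqP; rewrite !ffunE eqxx oner_eq0.
Qed.
HB.instance Definition _ := GRing.Zmodule_isNzRing.Build galg
  galg_mulA galg_mul1r galg_mulr1 galg_mulDl galg_mulDr galg_1neq0.

Fact galg_scalerAl (a : K) (u v : galg) : a *: (u * v) = (a *: u) * v.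
Proof.
apply/ffunP=> g; rewrite !ffunE scaler_sumr.
by apply: eq_bigr => x _; rewrite ffunE -mulrA.
Qed.
HB.instance Definition _ := GRing.Lmodule_isLalgebra.Build K galg galg_scalerAl.
End GroupAlgebra.

Section PowerSeries.
Variables (K : fieldType) (A : lalgType K).

(* Formal power series over A: f n is the coefficient of z^n *)
Definition fps := nat -> A.
Implicit Types f g : fps.

Definition fps_one : fps := fun n => (n == 0)%N%:R.
Definition fps_sub f g : fps := fun n => f n - g n.
Definition fps_mul f g : fps := fun n => \sum_(i < n.+1) f i * g (n - i)%N.
Definition fps_exp f k : fps := iter k (fps_mul f) fps_one.

(* ln f = sum_(k >= 1) (-1)^(k-1) (f-1)^k / k, for f with constant term 1: since
   (f-1)^k is then divisible by z^k, only k <= n contributes to z^n *)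
Definition fps_ln f : fps := fun n =>
  \sum_(1 <= k < n.+1) ((-1) ^+ k.-1 / k%:R) *: fps_exp (fps_sub f fps_one) k n.
End PowerSeries.

(* Only meaningful for n > 0 *)
Definition moebius (n : nat) : int :=
  if all (fun p => logn p n == 1)%N (primes n) then (-1) ^+ size (primes n) else 0.

Definition expgz (G : finGroupType) (x : G) (m : int) : G :=
  match m with Posz n => (x ^+ n)%g | Negz n => (x ^- n.+1)%g end.

Section Counting.
Variables (R : realType) (F : finFieldType) (l : nat).
Local Notation C := R[i].
Local Notation E := (typeII F l).

(* exp (2 pi sqrt(-1) / r) *)
Definition omega (r : nat) : C :=
  cos (2 * pi / r%:R) +i* sin (2 * pi / r%:R).

Definition monic_of_degree d : {set {poly_(d.+1) F}} :=
  [set p | (val p \is monic) && (size (val p) == d.+1)].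

Definition Icount d (e : E) : nat :=
  #|[set p in monic_of_degree d | irreducibleb (val p) && (cls l (val p) == e)]|.

Definition Fseries : fps (galg C E) :=
  fun d => \sum_(p in monic_of_degree d) galg_delta C (cls l (val p)).

(* n [z^n e] ln F(z) *)
Definition Ncoef n (e : E) : C := (n%:R : C) * fps_ln Fseries n e.

Definition classes_of_degree d : {set E} :=
  [set cls l (val p) | p in monic_of_degree d].

Section Decomposition.
Variables (f : nat) (xi : 'I_f -> E) (r : 'I_f -> nat).

Definition gen_prod (t : 'I_f -> int) : E := (\prod_(i < f) expgz (xi i) (t i))%g.

(* s : exponents stands for the vector of [r_1] x ... x [r_f] whose i-th
   coordinate is expo s i = s i + 1, as 'I_m starts at 0 and [m] at 1 *)
Definition exponents := {dffun forall i : 'I_f, 'I_(r i)}.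
Definition expo (s : exponents) (i : 'I_f) : nat := (s i).+1.
Definition expoz (s : exponents) (i : 'I_f) : int := expo s i.

Definition exponent_J : {set exponents} := [set j | [exists i, expo j i != r i]].

(* The v in [r_1] x ... x [r_f] with e = prod_i xi_i^(v_i); it exists and is unique
   when the group is the direct product of the <xi_i> and xi_i has order r_i *)
Definition expo_of (e : E) : 'I_f -> nat :=
  if [pick v : exponents | gen_prod (expoz v) == e] is Some v then expo v
  else fun=> 0.

Definition c_coef d (j : exponents) : C :=
  \sum_(e in classes_of_degree d)
    \prod_(i < f) omega (r i) ^+ (expo_of e i * expo j i).

Definition Ppoly (j : exponents) : {poly C} :=
  1 + \sum_(1 <= k < l.-1.+1) c_coef k j *: 'X^k.
End Decomposition.
End Counting.

Definition ln_poly (K : fieldType) (p : {poly K}) : nat -> K :=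
  fps_ln (fun k => p`_k : K^o).

(* The roots of p, listed with multiplicity (p != 0) *)
Definition roots_mult (K : closedFieldType) (p : {poly K}) : seq K :=
  sval (closed_field_poly_normal p).

(* Main.v *)
(** The characters chi_j of the type II group E send F(z) to Dirichlet-type
    series L_j(z).  A monic polynomial of degree at least l has its class
    equidistributed over E, so L_j is the polynomial P_j when chi_j is
    nontrivial, while the trivial character gives 1/(1 - q z).  Taking n [z^n] ln
    and inverting the Fourier transform on E yields the formulas for N_n.
    All logarithms are handled through the identity z L' = g L, which
    determines the power series g = z (ln L)': for L = 1/(1 - q z) it is a geometric
    series, for L = P_j a sum over roots, and for L = L_j unique factorization
    (deg f is the sum of deg p over the prime powers p^k dividing f) expresses
    g through the numbers I_d, so that N_n(e) is the sum over k | n of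
    (n/k) I_(n/k)(x) over the k-th roots x of e.  Moebius inversion then
    gives I_d. *)

Require Import Defs.
From mathcomp Require Import all_boot all_order all_algebra all_fingroup.
From mathcomp Require Import cyclic zify ring lra generic_quotient.
From mathcomp Require Import complex reals trigo.

Set Implicit Arguments.
Unset Strict Implicit.
Unset Printing Implicit Defensive.
Import Order.TTheory GRing.Theory Num.Theory.
Local Open Scope complex_scope.
Local Open Scope ring_scope.

(** * Logarithms of power series *)

Lemma fps_exp_coefp (K : fieldType) (p : {poly K}) k n :
  fps_exp (fun i => p`_i : K^o) k n = (p ^+ k)`_n.
Proof.
elim: k n => [|k IH] n; first by rewrite expr0 coef1.
by rewrite exprS coefM /fps_exp /= /fps_mul; apply: eq_bigr => i _; rewrite -IH.
Qed.

Lemma eq_fps_exp (K : fieldType) (A : lalgType K) (f g : fps A) n k m :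
  (forall i, (i <= n)%N -> f i = g i) -> (m <= n)%N ->
  fps_exp f k m = fps_exp g k m.
Proof.
move=> fg; elim: k m => [//|k IH] m mn.
rewrite /fps_exp /= /fps_mul; apply: eq_bigr => i _.
have im : (i <= m)%N by rewrite -ltnS.
by rewrite fg ?(leq_trans im) //; congr (_ * _); apply: IH; apply: leq_trans (leq_subr _ _) mn.
Qed.

(** A coefficient of the logarithm involves only the coefficients of the series up to the same
    degree, so in a fixed degree a series may be replaced by a polynomial truncation. *)
Lemma eq_fps_ln (K : fieldType) (A : lalgType K) (f g : fps A) n :
  (forall i, (i <= n)%N -> f i = g i) -> fps_ln f n = fps_ln g n.
Proof.
move=> fg; apply: eq_bigr => k _; congr (_ *: _); apply: (eq_fps_exp _ _ (leqnn n)) => i i_n.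
by rewrite /fps_sub fg.
Qed.

(** In each degree the logarithm is a finite expression in ring operations and scalars. This is
    applied to the transforms [hat j], from the group algebra to the scalars. *)
Lemma fps_ln_morph (K : fieldType) (A B : lalgType K) (phi : A -> B) (f : fps A) n :
  {morph phi : x y / x + y} -> scalable phi -> {morph phi : x y / x * y} -> phi 1 = 1 ->
  phi (fps_ln f n) = fps_ln (fun d => phi (f d)) n.
Proof.
move=> phiD phiZ phiM phi1.
have phi0 : phi 0 = 0 by rewrite -[0 in LHS](scale0r 0) phiZ scale0r.
have phi_sum := big_morph phi phiD phi0.
have phi_one d : phi (fps_one A d) = fps_one B d.
  by rewrite /fps_one; case: eqP; rewrite ?phi0 ?phi1.
rewrite /fps_ln phi_sum; apply: eq_bigr => k _; rewrite phiZ; congr (_ *: _).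
elim: k n => [|k IH] n; first exact: phi_one.
rewrite /fps_exp /= /fps_mul phi_sum; apply: eq_bigr => i _.
rewrite phiM /fps_sub -scaleN1r phiD phiZ phi_one scaleN1r; congr (_ * _); exact: IH.
Qed.

Lemma coef_exp_lt (K : fieldType) (p : {poly K}) k n :
  p`_0 = 0 -> (n < k)%N -> (p ^+ k)`_n = 0.
Proof.
move=> p0 nk; have /dvdpP[q ->] : 'X %| p.
  by rewrite -['X]subr0 dvdp_XsubCl rootE horner_coef0 p0.
by rewrite exprMn coefMXn nk.
Qed.

(* The power series identity z f' = g f, i.e. g = z (ln f)' *)
Definition log_deriv (K : fieldType) (f g : nat -> K) :=
  forall n, n%:R * f n = \sum_(i < n.+1) g i * f (n - i)%N.

(** In degree [n] the term [i = n] is [g n * f 0 = g n], and the other terms involve only earlier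
    values of [g]. *)
Lemma log_deriv_uniq (K : fieldType) (f g h : nat -> K) :
  f 0%N = 1 -> log_deriv f g -> log_deriv f h -> g =1 h.
Proof.
move=> f0 fg fh n; elim/ltn_ind: n => n IH.
move: (fg n); rewrite (fh n) !big_ord_recr /= subnn f0 !mulr1.
rewrite (eq_bigr (fun i : 'I_n => g i * f (n - i)%N)) => [/addrI-> //|i _].
by rewrite IH.
Qed.

(** Truncate [f] to a polynomial [p = 1 + h]. Differentiating the logarithm termwise gives a
    geometric sum in [- h], so that [L^]() * p[is]p^[()] up to an error that does not reach the
    degree considered. *)
Lemma log_deriv_ln (K : numFieldType) (f : nat -> K) :
  f 0%N = 1 -> log_deriv f (fun n => n%:R * fps_ln (f : fps K^o) n).
Proof.
move=> f0 n.
pose p : {poly K} := \poly_(i < n.+1) f i; pose h := p - 1.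
have pE i : (i <= n)%N -> p`_i = f i by rewrite coef_poly ltnS => ->.
have h0 : h`_0 = 0 by rewrite coefB coef1 pE // f0 subrr.
pose L := \sum_(1 <= k < n.+1) ((-1) ^+ k.-1 / k%:R) *: h ^+ k.
have LE i : (i <= n)%N -> fps_ln (f : fps K^o) i = L`_i.
  move=> i_n; rewrite /fps_ln /L coef_sum.
  (* The terms with [k > i] vanish, [h] having no constant term. *)
  rewrite [RHS](big_cat_nat (n := i.+1)) //= [X in _ + X]big_nat_cond [X in _ + X]big1 ?addr0.
    apply: eq_bigr => k _; rewrite coefZ -fps_exp_coefp; congr (_ *: _).
    apply: (@eq_fps_exp _ _ _ _ n) => // j jn.
    by rewrite /fps_sub /fps_one coefB coef1 pE.
  by move=> k; rewrite andbT => /andP[ik _]; rewrite coefZ coef_exp_lt ?mulr0.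
have hE : p^`() = h^`() by rewrite derivB derivC subr0.
have L'E : L^`() = h^`() * \sum_(k < n) (- h) ^+ k.
  rewrite /L big_add1 /= big_mkord raddf_sum mulr_sumr /=; apply: eq_bigr => k _.
  rewrite derivZ deriv_exp /= -scaler_nat scalerA divfK ?pnatr_eq0 //.
  by rewrite -[- h]scaleN1r exprZn scalerAr.
have L'p : L^`() * p = h^`() - h^`() * (- h) ^+ n.
  have -> : p = - (- h - 1) by rewrite -opprD opprK /h subrK.
  rewrite L'E mulrN -mulrA [X in _ * X]mulrC -subrX1 mulrBr mulr1 opprB.
  by [].
have coefXd (u : {poly K}) i : ('X * u^`())`_i = i%:R * u`_i.
  rewrite coefXM; case: i => [|i] /=; first by rewrite mul0r.
  by rewrite coef_deriv mulr_natl.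
(* The power [(- h) ^+ n] starts in degree [n], and the factor ['X] pushes the error beyond it. *)
have tail : ('X * (h^`() * (- h) ^+ n))`_n = 0.
  rewrite coefXM; case: ifP => // /negbT n0; rewrite coefM big1 // => i _.
  rewrite coef_exp_lt ?mulr0 ?coefN ?h0 ?oppr0 //.
  by rewrite (leq_ltn_trans (leq_subr _ _)) // ltn_predL lt0n.
transitivity ('X * h^`())`_n.
  rewrite coefXd -pE // /h coefB coef1.
  by case: (n) => [|m]; rewrite ?mul0r // subr0.
have -> : ('X * h^`())`_n = ('X * (L^`() * p))`_n.
  by rewrite L'p mulrBr coefB tail subr0.
rewrite mulrA coefM; apply: eq_bigr => i _.
have i_n : (i <= n)%N by rewrite -ltnS.
by rewrite coefXd -LE // pE ?leq_subr.
Qed.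

Lemma log_deriv_ln_uniq (K : numFieldType) (f g : nat -> K) n :
  f 0%N = 1 -> log_deriv f g -> n%:R * fps_ln (f : fps K^o) n = g n.
Proof. by move=> f0 fg; apply: (log_deriv_uniq f0 (log_deriv_ln f0) fg). Qed.

Lemma log_deriv_geom (K : fieldType) (a : K) :
  log_deriv (fun n => a ^+ n) (fun n => (0 < n)%N%:R * a ^+ n).
Proof.
move=> n; rewrite big_ord_recl mul0r mul0r add0r.
rewrite (eq_bigr (fun=> a ^+ n)) => [|i _]; last by rewrite /= mul1r -exprD subnKC // ltn_ord.
by rewrite sumr_const card_ord mulr_natl.
Qed.

(** Logarithmic derivatives add over the factors, and [1 - a *: 'X] contributes minus the geometric
    series of [a] without its constant term. *)
Lemma log_deriv_prod (K : fieldType) (s : seq K) :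
  log_deriv (fun n => (\prod_(a <- s) (1 - a *: 'X))`_n)
            (fun n => - \sum_(a <- s) (0 < n)%N%:R * a ^+ n).
Proof.
elim: s => [|a s IH] n.
  rewrite !big_nil coef1 big1 => [|i _]; last by rewrite big_nil oppr0 mul0r.
  by case: n => [|n]; rewrite ?mul0r ?mulr0.
rewrite big_cons; set p := \prod_(_ <- _) _ in IH *.
have pS m : ((1 - a *: 'X) * p)`_m.+1 = p`_m.+1 - a * p`_m.
  by rewrite mulrBl mul1r coefB -scalerAl coefZ coefXM.
case: n => [|n].
  by rewrite big_ord1 mul0r big1 ?oppr0 ?mul0r // => b _; rewrite mul0r.
(* Telescoping: as series, [a z / (1 - a z)] times [(1 - a z) p] is [a z p]. *)
have tele m : \sum_(i < m.+1) a ^+ i.+1 * ((1 - a *: 'X) * p)`_(m - i) = a * p`_m.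
  elim: m => [|m IHm].
    by rewrite big_ord1 subnn mulrBl mul1r coefB -scalerAl coefZ coefXM mulr0 subr0 expr1.
  rewrite big_ord_recl subn0 pS.
  under eq_bigr => i _ do rewrite subSS exprS -mulrA.
  by rewrite -mulr_sumr IHm expr1 mulrBr subrK.
rewrite pS mulrBr IH.
under [RHS]eq_bigr => i _ do rewrite big_cons opprD mulrDl.
rewrite big_split /= [X in _ = X + _]big_ord_recl !mul0r oppr0 mul0r add0r.
under [X in _ = X + _]eq_bigr => i _ do rewrite subSS mul1r mulNr.
rewrite sumrN tele.
rewrite [X in _ = _ + X]big_ord_recr /= subnn.
have -> : ((1 - a *: 'X) * p)`_0 = p`_0.
  by rewrite mulrBl mul1r coefB -scalerAl coefZ coefXM mulr0 subr0.
(* Expanding [(1 - a *: 'X) * p] leaves the sums of the induction hypothesis in degrees [n.+1] and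
   [n]. *)
under [X in _ = _ + (X + _)]eq_bigr => i _.
  rewrite subSn; last by rewrite -ltnS.
  rewrite pS mulrBr [_ * (a * _)]mulrCA -subSn; last by rewrite -ltnS.
  over.
rewrite sumrB -mulr_sumr -(IH n) [in LHS]big_ord_recr /= subnn -[n.+1]addn1 natrD.
ring.
Qed.

(** No root is 0, so each factor ['X - rho] is [- rho] times [1 - rho^-1 *: 'X]. Comparing constant
    terms shows that the leftover scalar [d] is 1. *)
Lemma prod_roots (K : closedFieldType) (p : {poly K}) : p`_0 = 1 ->
  p = \prod_(a <- [seq rho^-1 | rho <- roots_mult p]) (1 - a *: 'X).
Proof.
rewrite /roots_mult; case: closed_field_poly_normal => s /= ps p0.
have pn0 : p != 0.
  by apply/eqP=> p00; have := oner_neq0 K; rewrite -p0 p00 coef0 eqxx.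
set q := \prod_(_ <- _) _.
suff [d pE] : exists d, p = d *: q.
  suff q0 : q`_0 = 1 by move: p0; rewrite pE coefZ q0 mulr1 => ->; rewrite scale1r.
  rewrite -horner_coef0 horner_prod big1 // => a _.
  by rewrite !hornerE subr0.
exists (lead_coef p * \prod_(rho <- s) - rho).
rewrite -scalerA {1}ps /q big_map -scaler_prod; congr (_ *: _).
rewrite !big_seq; apply: eq_bigr => rho rs.
have r0 : rho != 0.
  apply: contra_eq_neq p0 => r0; rewrite -horner_coef0 -r0 eq_sym.
  suff /rootP -> : root p rho by rewrite oner_neq0.
  by rewrite ps rootZ ?lead_coef_eq0 // root_prod_XsubC.
by rewrite scalerBr !scaleNr opprK scalerA mulfV // scale1r addrC alg_polyC.
Qed.

Lemma ln_poly_roots (K : numClosedFieldType) (p : {poly K}) n : p`_0 = 1 -> (0 < n)%N ->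
  n%:R * ln_poly p n = - \sum_(rho <- roots_mult p) rho ^- n.
Proof.
move=> p0 n0; have := log_deriv_prod [seq rho^-1 | rho <- roots_mult p].
rewrite -prod_roots // => /(log_deriv_ln_uniq n p0) => ->.
by rewrite big_map n0; congr (- _); apply: eq_bigr => a _; rewrite mul1r exprVn.
Qed.

(** * Divisor sums and Moebius inversion *)

Lemma big_divisors_dvd (V : nmodType) (G : nat -> V) n d : (0 < n)%N -> (d %| n)%N ->
  \sum_(k <- divisors n | (k %| d)%N) G k = \sum_(k <- divisors d) G k.
Proof.
move=> n0 dn; have d0 := dvdn_gt0 n0 dn; rewrite -big_filter; apply: perm_big.
apply: uniq_perm; rewrite ?filter_uniq ?divisors_uniq // => k.
rewrite mem_filter -!dvdn_divisors //.
by case: (boolP (k %| d)%N) => // /dvdn_trans->.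
Qed.

Lemma big_divisors_mull (V : nmodType) (G : nat -> V) n d : (0 < n)%N -> (d %| n)%N ->
  \sum_(k <- divisors n | (d %| k)%N) G k = \sum_(k <- divisors (n %/ d)%N) G (d * k)%N.
Proof.
move=> n0 dn; have d0 := dvdn_gt0 n0 dn.
have m0 : (0 < n %/ d)%N by rewrite divn_gt0 // dvdn_leq.
rewrite -big_filter -[RHS](big_map (muln d) xpredT); apply: perm_big.
apply: uniq_perm; rewrite ?filter_uniq ?map_inj_uniq ?divisors_uniq //.
  by move=> x y /eqP; rewrite eqn_pmul2l // => /eqP.
move=> k; rewrite mem_filter -dvdn_divisors //; apply/andP/mapP => [[dk kn]|[m]].
  exists (k %/ d)%N; last by rewrite mulnC divnK.
  by rewrite -dvdn_divisors // dvdn_divRL // divnK.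
by rewrite -dvdn_divisors // dvdn_divRL // mulnC => mn ->; rewrite dvdn_mulr // mulnC.
Qed.

(** Both sides run over the chains of divisors [k %| d %| n], with [d = k * m]. *)
Lemma exchange_divisors (V : nmodType) (G : nat -> nat -> V) n : (0 < n)%N ->
  \sum_(k <- divisors n) \sum_(m <- divisors (n %/ k)%N) G k (k * m)%N =
  \sum_(d <- divisors n) \sum_(k <- divisors d) G k d.
Proof.
move=> n0.
under eq_big_seq => k kn do rewrite -(big_divisors_mull (G k)) ?dvdn_divisors //.
rewrite (exchange_big_dep xpredT) //=; apply: eq_big_seq => d dn.
by rewrite big_divisors_dvd // dvdn_divisors.
Qed.

(** Makes the ranges of [m] and [k] independent of [i], so that a further sum over [i] can be
    exchanged with them. *)
Lemma big_divisors_pairs (V : nmodType) (G : nat -> nat -> V) i n :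
  (forall k, G 0%N k = 0) -> (i <= n)%N ->
  \sum_(k <- divisors i) G (i %/ k)%N k =
  \sum_(1 <= k < n.+1) \sum_(1 <= m < n.+1 | (m * k == i)%N) G m k.
Proof.
case: (posnP i) => [->|i0] G0 i_n.
  (* For [i = 0] every quotient is 0 and [G0] applies, while no positive [m] and [k] have product
     0. *)
  under eq_bigr => k _ do rewrite div0n G0.
  rewrite big1_eq big_nat big1 // => k /andP[k0 _]; rewrite big_nat_cond big1 // => m.
  by rewrite muln_eq0; case: k m k0 => [//|k] [|m] /=; rewrite ?andbF.
transitivity (\sum_(1 <= k < n.+1) if (k %| i)%N then G (i %/ k)%N k else 0).
  rewrite -big_mkcond -[RHS]big_filter; apply: perm_big.
  apply: uniq_perm; rewrite ?filter_uniq ?divisors_uniq ?iota_uniq // => k.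
  rewrite mem_filter -dvdn_divisors // mem_index_iota ltnS.
  case: (boolP (k %| i)%N) => //= ki; symmetry.
  by rewrite (dvdn_gt0 i0 ki) (leq_trans (dvdn_leq i0 ki)).
apply: eq_big_nat => k /andP[k0 _]; case: (boolP (k %| i)%N) => ki.
  have := ki; rewrite dvdn_eq => /eqP ik.
  rewrite -big_filter (_ : filter _ _ = [:: (i %/ k)%N]) ?big_seq1 //.
  apply: perm_small_eq => //; apply: uniq_perm; rewrite ?filter_uniq ?iota_uniq // => m.
  rewrite mem_filter mem_index_iota mem_seq1 ltnS -{1}ik eqn_pmul2r //.
  case: eqP => //= ->; rewrite divn_gt0 // dvdn_leq //=.
  by rewrite (leq_trans (leq_div _ _)).
rewrite big1 // => m /eqP mk; move: ki; rewrite -mk dvdn_mull //.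
Qed.

Lemma big_divisors_le (V : nmodType) (G : nat -> nat -> V) n :
  (forall k, G 0%N k = 0) ->
  \sum_(i < n.+1) \sum_(k <- divisors i) G (i %/ k)%N k =
  \sum_(1 <= k < n.+1) \sum_(1 <= m < n.+1 | (m * k <= n)%N) G m k.
Proof.
move=> G0; under eq_bigr => i _ do rewrite (@big_divisors_pairs _ _ _ n) ?leq_ord //.
rewrite exchange_big; apply: eq_bigr => k _.
rewrite (exchange_big_dep (fun m => m * k <= n)%N) /=; last first.
  by move=> i m _ /eqP->; rewrite leq_ord.
apply: eq_bigr => m mk; rewrite (big_pred1 (inord (m * k))) // => i.
by apply/eqP/eqP => [mki|->]; [apply: val_inj; rewrite /= inordK | rewrite inordK].
Qed.

Lemma moebius_prime_mul p k : prime p -> (0 < k)%N -> ~~ (p %| k)%N ->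
  moebius (p * k) = - moebius k.
Proof.
move=> pp k0 pk; have p0 := prime_gt0 pp.
have pr : perm_eq (primes (p * k)) (p :: primes k).
  apply: uniq_perm; rewrite /= ?primes_uniq ?mem_primes ?(negPf pk) ?andbF // => x.
  by rewrite primesM // in_cons (primes_prime pp) mem_seq1.
rewrite /moebius (perm_all _ pr) (perm_size pr) /= lognM // logn_prime // eqxx.
rewrite lognE pp k0 (negPf pk) /=.
rewrite (eq_in_all (a2 := fun x => logn x k == 1%N)).
  by case: all; rewrite ?oppr0 // exprS mulN1r.
move=> x; rewrite mem_primes => /and3P[px _ xk].
by rewrite lognM // logn_prime //; case: (x =P p) => // xp; rewrite -xp xk in pk.
Qed.

Lemma moebius_sq p k : prime p -> (0 < k)%N -> (p %| k)%N -> moebius (p * k) = 0.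
Proof.
move=> pp k0 pk; have p0 := prime_gt0 pp.
rewrite /moebius; case: allP => // /(_ p).
rewrite mem_primes pp muln_gt0 p0 k0 dvdn_mulr // => /(_ isT).
by rewrite lognM // logn_prime // eqxx (lognE p k) pp k0 pk.
Qed.

(** Fix a prime [p] dividing [n]. Divisors divisible by the square of [p] contribute 0, and any
    other multiple [p * k] of [p] cancels against the divisor [k]. *)
Lemma sum_moebius n : (0 < n)%N -> \sum_(k <- divisors n) moebius k = (n == 1)%N%:R.
Proof.
move=> n0; case: eqP => [->|/eqP n1]; first by rewrite /divisors /= big_seq1.
have ppn : prime (pdiv n) by rewrite pdiv_prime // ltn_neqAle eq_sym n1.
move: (pdiv n) ppn (pdiv_dvd n) => p pp pn; have p0 := prime_gt0 pp.
have m0 : (0 < n %/ p)%N by rewrite divn_gt0 // dvdn_leq.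
have cop k : ~~ (p %| k)%N -> (k %| n)%N = (k %| n %/ p)%N.
  by move=> pk; rewrite -{1}(divnK pn) Gauss_dvdl // coprime_sym prime_coprime.
rewrite (bigID (dvdn p)) /= (big_divisors_mull moebius) //.
rewrite (bigID (dvdn p)) /= [X in X + _ + _]big_seq_cond [X in X + _ + _]big1 ?add0r; last first.
  move=> k /andP[]; rewrite -dvdn_divisors // => kn pk.
  by rewrite moebius_sq // (dvdn_gt0 m0).
rewrite big_seq_cond (eq_bigr (fun k => - moebius k)); last first.
  move=> k /andP[]; rewrite -dvdn_divisors // => kn pk.
  by rewrite moebius_prime_mul // (dvdn_gt0 m0).
rewrite -big_seq_cond sumrN addrC; apply/eqP; rewrite subr_eq0; apply/eqP.
rewrite -[LHS]big_filter -[RHS]big_filter; apply: perm_big.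
apply: uniq_perm; rewrite ?filter_uniq ?divisors_uniq // => k.
rewrite !mem_filter -!dvdn_divisors //.
by case: (boolP (p %| k)%N) => //= pk; rewrite cop.
Qed.

(** * Monic polynomials and their irreducible factors *)

Section Monics.
Variable F : finFieldType.
Implicit Types p g f : {poly F}.

Definition monics d : seq {poly F} := [seq val x | x in monic_of_degree F d].
Definition irreds d : seq {poly F} := [seq p <- monics d | irreducibleb p].

Lemma mem_monics p d : (p \in monics d) = (p \is monic) && (size p == d.+1).
Proof.
apply/imageP/andP => [[x]|[pm sp]]; first by rewrite inE => /andP[? ?] ->.
have sp' : (size p <= d.+1)%N by rewrite (eqP sp).
by exists (NPoly sp'); rewrite ?inE /= ?pm.
Qed.

Lemma monics_uniq d : uniq (monics d).
Proof. by rewrite map_inj_uniq ?enum_uniq //; exact: val_inj. Qed.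

Lemma big_monics (V : nmodType) (G : {poly F} -> V) d :
  \sum_(p <- monics d) G p = \sum_(x in monic_of_degree F d) G (val x).
Proof. by rewrite /monics big_image. Qed.

Lemma monics0 : monics 0 = [:: 1].
Proof.
apply: perm_small_eq => //; apply: uniq_perm; rewrite ?monics_uniq // => p.
rewrite mem_monics mem_seq1; apply/andP/eqP => [[pm /size_poly1P[c c0 pE]]|->].
  by move: pm; rewrite pE monicE lead_coefC => /eqP->.
by rewrite rpred1 size_poly1.
Qed.

Lemma irreds_monic d p : p \in irreds d -> p \is monic.
Proof. by rewrite mem_filter mem_monics => /and3P[]. Qed.

Lemma irreds_size d p : p \in irreds d -> size p = d.+1.
Proof. by rewrite mem_filter mem_monics => /and3P[_ _ /eqP]. Qed.

Lemma irreds_irr d p : p \in irreds d -> irreducible_poly p.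
Proof. by rewrite mem_filter => /andP[/irreducibleP]. Qed.

(** A nonconstant polynomial that is not irreducible has a nonconstant divisor of smaller degree, to
    which induction applies. *)
Lemma exists_irred_dvd f : (1 < size f)%N -> exists m, exists2 p, p \in irreds m & p %| f.
Proof.
have [n] := ubnP (size f); elim: n f => // n IH f sf f1.
have f0 : f != 0 by rewrite -size_poly_gt0 ltnW.
case: (boolP (irreducibleb f)) => [/irreducibleP firr|].
  have lc0 : lead_coef f != 0 by rewrite lead_coef_eq0.
  have lci : (lead_coef f)^-1 != 0 by rewrite invr_eq0.
  exists (size f).-1, ((lead_coef f)^-1 *: f); last by rewrite dvdpZl.
  rewrite mem_filter mem_monics size_scale // prednK ?size_poly_gt0 // eqxx andbT.
  rewrite monicE lead_coefZ mulVf // eqxx andbT; apply/irreducibleP.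
  split; first by rewrite size_scale.
  move=> q q1; rewrite dvdpZr // => /(firr.2 q q1) qf.
  by rewrite (eqp_trans qf) // eqp_sym eqp_scale.
rewrite /irreducibleb f1 /= negb_forall => /existsP[q].
rewrite negb_imply -dvdpE -ltnNge => /andP[qf q1].
have [|m [p pm pq]] := IH (val q) _ q1; last by exists m, p => //; apply: dvdp_trans pq qf.
by apply: leq_ltn_trans (size_npoly q) _; rewrite -ltnS prednK // ltnW.
Qed.

Lemma dvdp_exp_irred_neq p g k q : irreducible_poly p -> irreducible_poly q ->
  p \is monic -> q \is monic -> p != q -> (p ^+ k %| q * g) = (p ^+ k %| g).
Proof.
move=> pi qi pm qm pq; rewrite Gauss_dvdpr // coprimep_expl //.
rewrite irreducible_poly_coprime //; apply: contraNN pq => pq.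
by rewrite -eqp_monic //; apply: qi.2 pq; rewrite neq_ltn pi.1 orbT.
Qed.

(** The sum over [k] is the multiplicity of [p]; the bound on [size g] makes the range long enough
    to see all of it. *)
Lemma sum_dvd_exp_irred p g N : irreducible_poly p -> g \is monic -> (size g <= N)%N ->
  (\sum_(1 <= k < N.+1) (p ^+ k %| p * g)%R = (\sum_(1 <= k < N.+1) (p ^+ k %| g)%R).+1)%N.
Proof.
move=> pi gm; case: N => [|N] sg.
  by move: sg; rewrite leqNgt size_poly_gt0 monic_neq0.
have p0 := irredp_neq0 pi.
rewrite big_add1 /= big_nat_recl // expr1 dvdp_mulIl add1n; congr _.+1.
(* The last term, for the power [p ^+ N.+1], is 0 because its degree exceeds that of [g]; the others
   match after cancelling [p]. *)
rewrite big_add1 /= big_nat_recr //= [X in (_ = _ + nat_of_bool X)%N](_ : _ = false) ?addn0.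
  by apply: eq_bigr => k _; rewrite exprS dvdp_mul2l.
apply/negP => /(dvdp_leq (monic_neq0 gm)); apply/negP; rewrite -ltnNge.
rewrite (leq_ltn_trans sg) // -[X in (_ < X)%N]prednK ?size_poly_gt0 ?expf_neq0 // size_exp ltnS.
by rewrite leq_pmull // -ltnS prednK ?pi.1 // ltnW // pi.1.
Qed.

(** Induction on the degree: for [f = g * p] with [p] irreducible of degree [d], passing from [g] to
    [f] raises only the multiplicity of [p], by one, which adds [d]. The bound [N] stays fixed so
    that both sums have the same ranges. *)
Lemma sum_deg_irred_dvd f n N : f \in monics n -> (n <= N)%N ->
  (\sum_(1 <= m < N.+1) \sum_(p <- irreds m) m * \sum_(1 <= k < N.+1) (p ^+ k %| f)%R = n)%N.
Proof.
elim/ltn_ind: n f => n IH f; rewrite mem_monics => /andP[fm /eqP sf] nN.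
case: (posnP n) => [n0|n0].
  rewrite n0 big_nat big1 // => m /andP[m0 _]; rewrite big_seq big1 // => p pm.
  rewrite big_nat big1 ?muln0 // => k /andP[k0 _].
  case: (boolP (p ^+ k %| f)) => // pk.
  have : p %| f by apply: dvdp_trans pk; rewrite -[X in X %| _]expr1 dvdp_exp2l.
  by move/(dvdp_leq (monic_neq0 fm)); rewrite sf n0 (irreds_size pm) ltnS leqn0 eqn0Ngt m0.
have [|d [p pd /dvdpP[g fE]]] := @exists_irred_dvd f; first by rewrite sf.
have pm := irreds_monic pd; have pi := irreds_irr pd; have sp := irreds_size pd.
have gm : g \is monic by rewrite fE monicMr in fm.
have d0 : (0 < d)%N by rewrite -ltnS -sp pi.1.
have ndE : n = (d + (size g).-1)%N.
  move: sf; rewrite fE size_Mmonic ?monic_neq0 // sp addnS /= => sgd.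
  by move: sgd (monic_neq0 gm); rewrite -size_poly_gt0; case: (size g) => //= s [<-]; rewrite addnC.
have gM : g \in monics (size g).-1 by rewrite mem_monics gm prednK ?size_poly_gt0 ?monic_neq0 //=.
have gn : ((size g).-1 < n)%N by rewrite ndE -[X in (X < _)%N]add0n ltn_add2r.
have gN : (size g <= N)%N.
  by rewrite (leq_trans _ nN) // (leq_trans _ gn) // prednK ?size_poly_gt0 ?monic_neq0.
have := IH _ gn g gM (leq_trans (ltnW gn) nN).
have dN : (d \in index_iota 1 N.+1).
  by rewrite mem_index_iota d0 ltnS (leq_trans _ nN) // ndE leq_addr.
rewrite (bigD1_seq d) ?iota_uniq //= (bigD1_seq p) ?filter_uniq ?monics_uniq //= => gE.
rewrite (bigD1_seq d) ?iota_uniq //= (bigD1_seq p) ?filter_uniq ?monics_uniq //=.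
rewrite fE mulrC sum_dvd_exp_irred // mulnS.
rewrite ndE -[in RHS]gE -!addnA; congr (_ + (_ + _))%N.
congr (_ + _)%N.
  rewrite big_seq_cond [RHS]big_seq_cond; apply: eq_bigr => q /andP[qd qp].
  congr (_ * _)%N; apply: eq_bigr => k _.
  by rewrite (dvdp_exp_irred_neq _ _ (irreds_irr qd) pi (irreds_monic qd)).
apply: eq_bigr => m md; rewrite big_seq [RHS]big_seq; apply: eq_bigr => q qm.
congr (_ * _)%N; apply: eq_bigr => k _.
rewrite (dvdp_exp_irred_neq _ _ (irreds_irr qm) pi (irreds_monic qm)) //.
by apply: contraNneq md => qp; rewrite -eqSS -(irreds_size qm) qp sp.
Qed.

Lemma big_monics_dvd (V : nmodType) (G : {poly F} -> V) d p n :
  p \in monics d -> (d <= n)%N ->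
  \sum_(f <- monics n | p %| f) G f = \sum_(g <- monics (n - d)) G (p * g).
Proof.
rewrite mem_monics => /andP[pm /eqP sp] dn.
rewrite -big_filter -[RHS](big_map (fun g => p * g) xpredT); apply: perm_big.
apply: uniq_perm; first by rewrite filter_uniq ?monics_uniq.
  rewrite map_inj_uniq ?monics_uniq // => a b.
  by apply: mulfI; rewrite monic_neq0.
have szM g : g != 0 -> (size (p * g) == n.+1) = (size g == (n - d).+1).
  rewrite -size_poly_gt0 => g0; rewrite size_monicM -?size_poly_gt0 // sp.
  by case: (size g) g0 => // s _; rewrite addSn addnS /= !eqSS eq_sym -{1}(subnKC dn) eqn_add2l eq_sym.
move=> f; rewrite mem_filter mem_monics; apply/and3P/mapP => [[/dvdpP[g ->]]|[g]].
  rewrite monicMr // mulrC => gm sg; exists g => //.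
  by rewrite mem_monics gm -szM ?monic_neq0.
rewrite mem_monics => /andP[gm sg] ->; split; rewrite ?dvdp_mulIl ?monicMl //.
by rewrite szM ?monic_neq0.
Qed.

(* Von Mangoldt: deg f is the sum of deg p over the prime powers p^k dividing f. *)
Lemma log_deriv_monics (K : fieldType) (chi : {poly F} -> K) :
  chi 1 = 1 -> {in monic &, {morph chi : p q / p * q}} ->
  log_deriv (fun d => \sum_(f <- monics d) chi f)
    (fun n => \sum_(k <- divisors n) (n %/ k)%N%:R * \sum_(p <- irreds (n %/ k)) chi p ^+ k).
Proof.
move=> chi1 chiM n.
have chiX p k : p \is monic -> chi (p ^+ k) = chi p ^+ k.
  by move=> pm; elim: k => [|k IH]; rewrite ?expr0 // !exprS chiM ?monic_exp ?IH.
(* The contribution of the powers [p ^+ k] with [p] of degree [m]. The right side becomes the sum of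
   [G m k] over [m * k <= n]. *)
pose G m k := m%:R * \sum_(p <- irreds m) \sum_(f <- monics n | p ^+ k %| f) chi f.
transitivity (\sum_(i < n.+1) \sum_(k <- divisors i) G (i %/ k)%N k); last first.
  apply: eq_bigr => i _; rewrite mulr_suml; case: (posnP i) => [->|i0].
    by apply: eq_bigr => k _; rewrite div0n /G !mul0r.
  apply: eq_big_seq => k; rewrite -dvdn_divisors // => ki.
  rewrite /G -mulrA mulr_suml; congr (_ * _); apply: eq_big_seq => p pi.
  have pm := irreds_monic pi.
  have pki : p ^+ k \in monics i.
    rewrite mem_monics monic_exp //= -(divnK ki) -[size _]prednK ?size_poly_gt0 ?monic_neq0 ?monic_exp //.
    by rewrite size_exp (irreds_size pi).
  rewrite (big_monics_dvd _ pki) ?leq_ord // -chiX // mulr_sumr; apply: eq_big_seq => g.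
  by rewrite mem_monics => /andP[gm _]; rewrite chiM ?monic_exp.
rewrite big_divisors_le => [|k]; last by rewrite /G mul0r.
(* Pairs with [m * k > n] may be added: no [f] of degree [n] is divisible by a polynomial of degree
   [m * k]. *)
transitivity (\sum_(1 <= k < n.+1) \sum_(1 <= m < n.+1) G m k); last first.
  apply: eq_bigr => k _; rewrite [RHS]big_mkcond; apply: eq_bigr => m _ /=.
  case: leqP => // mk; rewrite /G big_seq big1 ?mulr0 // => p pm.
  rewrite big_seq_cond big1 // => f /andP[]; rewrite mem_monics => /andP[fm /eqP sf].
  move/(dvdp_leq (monic_neq0 fm)); rewrite sf -[size _]prednK.
    by rewrite size_exp (irreds_size pm) ltnS leqNgt mk.
  by rewrite size_poly_gt0 expf_neq0 // monic_neq0 // (irreds_monic pm).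
rewrite exchange_big /= mulr_sumr.
(* The factor [n] is replaced, separately for each [f], by the sum of [sum_deg_irred_dvd]. *)
transitivity (\sum_(f <- monics n) (\sum_(1 <= m < n.+1) \sum_(p <- irreds m)
    m * \sum_(1 <= k < n.+1) (p ^+ k %| f)%R)%N%:R * chi f).
  by apply: eq_big_seq => f fn; rewrite (sum_deg_irred_dvd fn).
under [LHS]eq_bigr => f _ do rewrite natr_sum mulr_suml.
rewrite exchange_big /=; apply: eq_bigr => m _.
under [LHS]eq_bigr => f _ do rewrite natr_sum mulr_suml.
rewrite exchange_big /= /G -mulr_sumr [in RHS]exchange_big mulr_sumr; apply: eq_bigr => p _.
under [LHS]eq_bigr => f _ do rewrite natrM -mulrA natr_sum mulr_suml.
rewrite -mulr_sumr exchange_big /=; congr (_ * _); apply: eq_bigr => k _.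
by rewrite [RHS]big_mkcond; apply: eq_bigr => f _; case: ifP; rewrite ?mul1r ?mul0r.
Qed.
End Monics.

(** * Equidistribution of the classes *)

(** Cuts a monic polynomial into its leading part [p], which will determine the class, and an
    arbitrary tail [h] below ['X^m]. *)
Lemma perm_monics (F : finFieldType) l m :
  perm_eq (monics F (l + m))
    [seq p * 'X^m + val h | p <- monics F l, h <- enum {: {poly_m F}}].
Proof.
apply: uniq_perm; first exact: monics_uniq.
  apply: allpairs_uniq; rewrite ?monics_uniq ?enum_uniq // => -[p h] [p' h'] _ _ /= e.
  rewrite addrC [RHS]addrC in e; congr pair.
    by rewrite -(drop_polyDMXn p (size_npoly h)) e drop_polyDMXn ?size_npoly.
  by apply: val_inj; rewrite /= -(take_polyDMXn p (size_npoly h)) e take_polyDMXn ?size_npoly.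
move=> f; rewrite mem_monics; apply/andP/allpairsP => [[fm /eqP sf]|[[p h] /= []]].
  exists (drop_poly m f, npolyp m (take_poly m f)) => /=.
  rewrite mem_enum mem_monics size_drop_poly sf -addSn addnK eqxx andbT npolypK ?size_take_poly //.
  split=> //; last by rewrite addrC poly_take_drop.
  rewrite monicE lead_coefE size_drop_poly sf -addSn addnK coef_drop_poly.
  by move: fm; rewrite monicE lead_coefE sf.
rewrite mem_monics => /andP[pm /eqP sp] _ ->.
have szX : size (p * 'X^m) = (l + m).+1 by rewrite size_mulXn ?monic_neq0 // sp addnS addnC.
have hp : (size (val h) < size (p * 'X^m)%R)%N.
  by rewrite szX ltnS (leq_trans (size_npoly h)) // leq_addl.
by rewrite monicE lead_coefDl // -monicE monicMl // monicXn size_polyDl // szX.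
Qed.

Lemma size_monics (F : finFieldType) d : size (monics F d) = (#|F| ^ d)%N.
Proof.
rewrite -[d]add0n (perm_size (perm_monics F 0 d)) size_allpairs monics0 mul1n.
by rewrite -cardE card_npoly.
Qed.

Section Classes.
Variables (F : finFieldType) (l : nat).
Implicit Types p q : {poly F}.

Lemma coef_reciprocal p d i : size p = d.+1 ->
  (reciprocal p)`_i = if (i <= d)%N then p`_(d - i) else 0.
Proof. by move=> sp; rewrite /reciprocal coef_revpoly sp. Qed.

Lemma eq_clsP p q : p \is monic -> q \is monic ->
  reflect (forall i, (i <= l)%N -> (reciprocal p)`_i = (reciprocal q)`_i)
          (cls l p == cls l q).
Proof.
move=> pm qm; rewrite eq_cls // -!Pdiv.IdomainMonic.take_poly_modp.
apply: (iffP eqP) => [pq i i_l|pq]; last first.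
  by apply/polyP => i; rewrite !coef_take_poly; case: ltnP => // /pq.
by have := congr1 (fun f : {poly F} => f`_i) pq; rewrite !coef_take_poly ltnS i_l.
Qed.

(** In degree at most [l] the class records every coefficient. *)
Lemma cls_inj d : (d <= l)%N -> {in monics F d &, injective (cls l)}.
Proof.
move=> dl p q; rewrite !mem_monics => /andP[pm /eqP sp] /andP[qm /eqP sq] /eqP/eq_clsP pq.
apply/polyP => i; have [di|id] := ltnP d i; first by rewrite !nth_default ?sp ?sq.
have := pq pm qm (d - i)%N (leq_trans (leq_subr _ _) dl).
by rewrite (coef_reciprocal _ sp) (coef_reciprocal _ sq) leq_subr subKn.
Qed.

Lemma cls_surj (e : typeII F l) : exists2 p, p \in monics F l & cls l p = e.
Proof.
rewrite -[e]typeII_codeK; set s := typeII_code e.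
have s0 : (val s)`_0 = 1.
  rewrite /s /typeII_code /= npolypK ?size_take_poly // coef_take_poly.
  by rewrite reciprocal_coef0 //; exact: valP (repr e).
have [ms _] := reciprocal_revpoly l s0; exists (revpoly l (val s)) => //.
by rewrite mem_monics ms size_poly_eq //= subnn s0 oner_eq0.
Qed.

(** The class reads the coefficients from degree [l + m] down to [m], which [h] does not reach. *)
Lemma cls_mulXnD p (h : {poly F}) m : p \in monics F l -> (size h <= m)%N ->
  cls l (p * 'X^m + h) = cls l p.
Proof.
move=> pl hm; have fl : p * 'X^m + h \in monics F (l + m).
  rewrite (perm_mem (perm_monics F l m)).
  by apply/allpairsP; exists (p, NPoly hm); rewrite /= mem_enum.
move: pl fl; rewrite !mem_monics => /andP[pm /eqP sp] /andP[fm /eqP sf].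
apply/eqP/eq_clsP => // i i_l; rewrite (coef_reciprocal _ sp) (coef_reciprocal _ sf) i_l.
rewrite (leq_trans i_l) ?leq_addr // -addnBAC // coefD coefMXn addnK.
by rewrite ltnNge leq_addl /= [h`__]nth_default ?addr0 // (leq_trans hm) // leq_addl.
Qed.

Lemma perm_cls_monics : perm_eq (map (cls l) (monics F l)) (enum {: typeII F l}).
Proof.
apply: uniq_perm; rewrite ?enum_uniq //.
  by rewrite map_inj_in_uniq ?monics_uniq //; exact: cls_inj (leqnn l).
move=> e; rewrite mem_enum; apply/mapP.
by have [p pl pe] := cls_surj e; exists p.
Qed.

Lemma card_typeII : #|{: typeII F l}| = (#|F| ^ l)%N.
Proof. by rewrite cardE -(perm_size perm_cls_monics) size_map size_monics. Qed.

(** Equidistribution: the tail does not affect the class, there are [#|F| ^ m] tails, and the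
    leading parts of degree [l] hit every class once. *)
Lemma big_cls_monics (V : nmodType) (G : typeII F l -> V) m :
  \sum_(p <- monics F (l + m)) G (cls l p) = (\sum_e G e) *+ (#|F| ^ m).
Proof.
rewrite (perm_big _ (perm_monics F l m)) big_allpairs_dep.
have -> : \sum_e G e = \sum_(p <- monics F l) G (cls l p).
  by rewrite -(big_map (cls l) xpredT G) (perm_big _ perm_cls_monics) big_enum.
rewrite -sumrMnl; apply: eq_big_seq => p pl.
rewrite big_enum /= (eq_bigr (fun=> G (cls l p))) => [|h _].
  by rewrite sumr_const card_npoly.
by rewrite cls_mulXnD ?size_npoly.
Qed.

Lemma big_classes_of_degree (V : nmodType) (G : typeII F l -> V) d : (d <= l)%N ->
  \sum_(e in classes_of_degree F l d) G e = \sum_(p <- monics F d) G (cls l p).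
Proof.
move=> dl; rewrite big_imset ?big_monics // => x y xd yd xy.
apply/val_inj/(cls_inj dl) => //; by apply: image_f.
Qed.
End Classes.

(** * Characters of the type II group *)

Lemma expgzS (G : finGroupType) (x : G) (m : int) : expgz x (m + 1) = (expgz x m * x)%g.
Proof.
case: m => [n|[|n]]; first by rewrite addrC -intS /= expgSr.
  by rewrite (_ : Negz 0 + 1 = 0) //= expg1 mulVg.
have -> : (Negz n.+1 + 1 = Negz n)%R by rewrite !NegzE; lia.
by rewrite /= [(x ^+ n.+2)%g]expgS invMg mulgKV.
Qed.

Lemma expgzD (G : finGroupType) (x : G) (m n : int) :
  expgz x (m + n) = (expgz x m * expgz x n)%g.
Proof.
have pred k : expgz x (k - 1) = (expgz x k * x^-1)%g.
  by rewrite -[k in RHS](subrK 1) expgzS mulgK.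
elim/int_rect: n => [|n IH|n IH]; first by rewrite addr0 mulg1.
  by rewrite intS [1 + _]addrC addrA !expgzS IH mulgA.
by rewrite intS opprD [-1 + _]addrC addrA !pred IH mulgA.
Qed.

Lemma expgz_eq1 (G : finGroupType) (x : G) (m : int) : (expgz x m == 1%g) = (#[x]%g %| m)%Z.
Proof. by case: m => n; rewrite dvdzE /= ?invg_eq1 -order_dvdn. Qed.

Lemma expgz_cycle (G : finGroupType) (x : G) (m : int) : expgz x m \in <[x]>%g.
Proof. by case: m => n /=; rewrite ?groupV mem_cycle. Qed.

(** * Primitive roots of unity in [R[i]] *)

Section Omega.
Variable R : realType.

(** De Moivre's formula. *)
Lemma omegaX r m : omega R r ^+ m =
  cos (2 * pi / r%:R * m%:R) +i* sin (2 * pi / r%:R * m%:R).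
Proof.
rewrite /omega; set a := 2 * pi / r%:R : R.
elim: m => [|m IH]; first by rewrite expr0 mulr0 cos0 sin0.
have -> : a * m.+1%:R = a * m%:R + a by rewrite -natr1 mulrDr mulr1.
rewrite exprSr IH cosD sinD; apply/eqP; rewrite eq_complex /= eqxx /=.
by rewrite addrC.
Qed.

Lemma omega_prim r : (0 < r)%N -> r.-primitive_root (omega R r).
Proof.
move=> r0; have r0' : (0 : R) < r%:R by rewrite ltr0n.
apply/andP; split=> //; apply/forallP => i; rewrite unity_rootE omegaX.
case: (i.+1 =P r) => [->|/eqP ir]; apply/eqP.
  rewrite divfK; last by rewrite pnatr_eq0 -lt0n.
  rewrite mulr_natl cos2pi -[X in sin X]add0r sinD2pi sin0.
  by rewrite eqxx.
(* The real part is already different from 1: it is [cos (x *+ 2)], that is one minus twice the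
   square of [sin x], with [x] strictly between 0 and [pi]. *)
apply/negbTE; rewrite eq_complex /= negb_and; apply/orP; left.
set x := pi / r%:R * i.+1%:R : R.
have -> : 2 * pi / r%:R * i.+1%:R = x *+ 2 :> R by rewrite /x -[RHS]mulr_natl !mulrA.
have sx : 0 < sin x.
  apply: sin_gt0_pi; rewrite /x !mulr_gt0 ?pi_gt0 ?invr_gt0 ?ltr0n //=.
  rewrite -mulrA gtr_pMr ?pi_gt0 // mulrC ltr_pdivrMr // mul1r ltr_nat.
  by rewrite ltn_neqAle ir /=.
apply: contraTneq sx => c1.
have := cos_mulr2n x; rewrite c1 cos2sin2 => e.
have : sin x ^+ 2 = 0 by lra.
by move/eqP; rewrite sqrf_eq0 => /eqP->; rewrite ltxx.
Qed.

End Omega.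

Lemma prim_root_neq0 (K : fieldType) n (z : K) : n.-primitive_root z -> z != 0.
Proof.
move=> zn; apply: contra_eq_neq (prim_expr_order zn) => ->.
by rewrite expr0n gtn_eqF ?(prim_order_gt0 zn) // eq_sym oner_neq0.
Qed.

Lemma eq_prim_root_expz (K : fieldType) n (z : K) (a b : int) : n.-primitive_root z ->
  (z ^ a == z ^ b) = (a == b %[mod n])%Z.
Proof.
move=> zn; have z0 := prim_root_neq0 zn.
rewrite -subr_eq0 -[X in _ - X]mul1r -{1}[a](subrK b) expfzDr // -mulrBl.
rewrite mulf_eq0 (negPf (expfz_neq0 _ z0)) orbF subr_eq0 eqz_mod_dvd.
case: (a - b) => k; rewrite dvdzE /=.
  by rewrite -exprnP -(prim_order_dvd zn).
by rewrite NegzE -exprnN invr_eq1 -(prim_order_dvd zn).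
Qed.

Section Characters.
Variables (K : numFieldType) (F : finFieldType) (l f : nat).
Variables (xi : 'I_f -> typeII F l) (r : 'I_f -> nat) (w : 'I_f -> K).
Hypothesis hr : forall i, #[xi i]%g = r i.
Hypothesis hxi : (\big[dprod/1]_(i < f) <[xi i]>)%g = [set: typeII F l].
Hypothesis w_prim : forall i, (r i).-primitive_root (w i).
Local Notation E := (typeII F l).
Implicit Types (t : 'I_f -> int) (e x y : E) (j : exponents r).

Let r_gt0 i : (0 < r i)%N. Proof. by rewrite -hr order_gt0. Qed.

Lemma gen_prodD t t' :
  gen_prod xi (fun i => t i + t' i) = (gen_prod xi t * gen_prod xi t')%g.
Proof.
have mulC x y : (x * y = y * x)%g by apply: (centsP (typeII_abelian F l)); rewrite inE.
rewrite /gen_prod; elim/big_rec3: _ => [|i x y z _ ->]; first by rewrite mulg1.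
by rewrite expgzD !mulgA; congr (_ * _)%g; rewrite -!mulgA; congr (_ * _)%g.
Qed.

Lemma gen_prodX t k : gen_prod xi (fun i => k%:Z * t i) = (gen_prod xi t ^+ k)%g.
Proof.
elim: k => [|k IH]; first by rewrite /gen_prod big1 // => i _; rewrite mul0r.
rewrite expgS -IH -gen_prodD; apply: eq_bigr => i _.
by rewrite intS mulrDl mul1r.
Qed.

(** Components in a direct product are unique, and 1 also decomposes into trivial components. *)
Lemma gen_prod_eq1 t : (gen_prod xi t == 1%g) = [forall i, (r i %| t i)%Z].
Proof.
under eq_forallb => i do rewrite -hr -expgz_eq1.
apply/eqP/forallP => [t1|t1]; last by rewrite /gen_prod big1 // => i _; apply/eqP.
have [c [_ _ uc]] := mem_bigdprod hxi (in_setT (1%g : E)).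
move=> i; apply/eqP.
rewrite (uc (fun i => expgz (xi i) (t i))) //; last by move=> k _; exact: expgz_cycle.
by rewrite -(uc (fun=> 1%g)) // big1.
Qed.

Lemma eq_gen_prod t t' :
  (gen_prod xi t == gen_prod xi t') = [forall i, (t i == t' i %[mod r i])%Z].
Proof.
under eq_forallb => i do rewrite eqz_mod_dvd.
rewrite -gen_prod_eq1 -[LHS](inj_eq (mulIg (gen_prod xi t')^-1%g)) mulgV.
congr (_ == _); apply: (mulIg (gen_prod xi t')).
by rewrite mulgKV -gen_prodD; apply: eq_bigr => i _; rewrite subrK.
Qed.

Lemma expoz_surj e : exists s : exponents r, gen_prod xi (expoz s) == e.
Proof.
have [c [cx -> _]] := mem_bigdprod hxi (in_setT e).
have /fin_all_exists[m mE] i : exists m, c i = (xi i ^+ m)%g by apply/cycleP/cx.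
(* As [expo] adds 1, the index must be congruent to [m i - 1]; adding [(r i).-1] avoids a truncated
   subtraction. *)
have lt_s i : ((m i + (r i).-1) %% r i < r i)%N by rewrite ltn_mod.
exists [ffun i => Ordinal (lt_s i)]; apply/eqP/eq_bigr => i _.
rewrite mE /expoz /= /expo ffunE /=; apply/eqP; rewrite eq_expg_mod_order hr.
by rewrite -addn1 modnDml -addnA addn1 prednK ?r_gt0 // modnDr.
Qed.

Lemma expoz_bij : bijective (fun s : exponents r => gen_prod xi (expoz s)).
Proof.
have inj : injective (fun s : exponents r => gen_prod xi (expoz s)).
  move=> s s' /eqP; rewrite eq_gen_prod => /forallP ss'; apply/ffunP => i.
  have := ss' i; rewrite /expoz /expo !intS eqz_modDl !modz_nat.
  by rewrite !modn_small ?ltn_ord // => /eqP[/val_inj].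
exists (fun e => xchoose (expoz_surj e)) => s; last exact/eqP/(xchooseP (expoz_surj s)).
by apply: inj; apply/eqP/(xchooseP (expoz_surj _)).
Qed.

(** A decomposition always exists, so the default value of [expo_of] is never taken. *)
Lemma gen_expo_of e : gen_prod xi (fun i => (expo_of xi r e i)%:Z) = e.
Proof.
rewrite /expo_of; case: pickP => [v /eqP //|nov].
by have [s] := expoz_surj e; rewrite nov.
Qed.

(** The character of the group indexed by [j]; for [w i = omega R (r i)] its values are the summands
    of [c_coef]. *)
Definition chi j e : K := \prod_(i < f) w i ^+ (expo_of xi r e i * expo j i).

(** Since [w i] has order [r i], the exponents chosen by [expo_of] may be replaced by any congruent
    ones. *)
Lemma chi_gen j t : chi j (gen_prod xi t) = \prod_(i < f) w i ^ (expoz j i * t i).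
Proof.
apply: eq_bigr => i _; apply/eqP; rewrite exprnP (eq_prim_root_expz _ _ (w_prim i)).
have := gen_expo_of (gen_prod xi t) => /eqP; rewrite eq_gen_prod => /forallP/(_ i).
by rewrite !eqz_mod_dvd PoszM mulrC -mulrBr => /dvdz_mull ->.
Qed.

Lemma chi1 j : chi j 1%g = 1.
Proof.
have <- : gen_prod xi (fun=> 0) = 1%g by rewrite /gen_prod big1.
by rewrite chi_gen big1 // => i _; rewrite mulr0.
Qed.

Lemma chiM j : {morph chi j : x y / (x * y)%g >-> x * y}.
Proof.
move=> x y; rewrite -(gen_expo_of x) -(gen_expo_of y) -gen_prodD !chi_gen -big_split /=.
by apply: eq_bigr => i _; rewrite mulrDr expfzDr // (prim_root_neq0 (w_prim i)).
Qed.

Lemma chiX j x k : chi j (x ^+ k)%g = chi j x ^+ k.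
Proof. by elim: k => [|k IH]; rewrite ?expr0 ?chi1 // expgS exprS chiM IH. Qed.

Lemma chiV_gen j t :
  chi j (gen_prod xi t)^-1%g = \prod_(i < f) w i ^ (- (expoz j i * t i)).
Proof.
have -> : ((gen_prod xi t)^-1 = gen_prod xi (fun i => - t i))%g.
  apply: (mulIg (gen_prod xi t)); rewrite mulVg -gen_prodD /gen_prod big1 // => i _.
  by rewrite addNr.
by rewrite chi_gen; apply: eq_bigr => i _; rewrite mulrN.
Qed.

(** Translation by a generator [xi i] with [expo j i != r i] multiplies the sum by a scalar other
    than 1. *)
Lemma sum_chi_group j : j \in exponent_J r -> \sum_e chi j e = 0.
Proof.
rewrite inE => /existsP[i ji].
pose x := gen_prod xi (fun k => (k == i)%:Z).
have xE : chi j x = w i ^ expoz j i.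
  rewrite chi_gen (bigD1 i) //= eqxx mulr1 big1 ?mulr1 // => k /negPf->.
  by rewrite mulr0.
have x1 : chi j x != 1.
  rewrite xE -[1](expr0z (w i)) (eq_prim_root_expz _ _ (w_prim i)) eqz_mod_dvd subr0 dvdzE /=.
  (* As [0 < expo j i <= r i], divisibility by [r i] would force equality. *)
  by apply: contra ji => /dvdn_leq le_rj; rewrite eqn_leq le_rj // ltn_ord.
have : \sum_e chi j e = chi j x * \sum_e chi j e.
  rewrite mulr_sumr [LHS](reindex_inj (mulgI x)).
  by apply: eq_bigr => e _; rewrite chiM.
move/eqP; rewrite -subr_eq0 -{1}[\sum_e _]mul1r -mulrBl mulf_eq0 subr_eq0 eq_sym (negPf x1).
by move/eqP.
Qed.

(* Increasing one coordinate of j cyclically multiplies chi j x by a root of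
   unity other than 1. *)
Lemma sum_chi_dual x : \sum_j chi j x = #|{: E}|%:R * (x == 1%g)%:R.
Proof.
case: eqP => [->|/eqP x1]; rewrite ?mulr1 ?mulr0.
  under eq_bigr => j _ do rewrite chi1.
  by rewrite sumr_const (bij_eq_card expoz_bij).
have [i ri] : exists i, ~~ (r i %| expo_of xi r x i)%N.
  apply/existsP; rewrite -negb_forall; apply: contra x1.
  by rewrite -{2}(gen_expo_of x) gen_prod_eq1.
pose v := expo_of xi r x i.
pose sh j : exponents r := [ffun k => if k == i then ordS (j k) else j k].
have sh_inj : injective sh.
  move=> j j' /ffunP jj'; apply/ffunP => k; have := jj' k; rewrite !ffunE.
  by case: eqP => // _ /ordS_inj.
have shE j : chi (sh j) x = w i ^+ v * chi j x.
  rewrite /chi (bigD1 i) //= [in RHS](bigD1 i) //= mulrA; congr (_ * _); last first.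
    by apply: eq_bigr => k /negPf ki; rewrite /expo ffunE ki.
  (* [ordS] wraps around modulo [r i], which is harmless because [w i ^+ v] is an [r i]-th root of
     unity. *)
  rewrite /expo ffunE eqxx -exprD -mulnS /= !exprM.
  have wr : (w i ^+ v) ^+ r i = 1.
    by rewrite exprAC (prim_expr_order (w_prim i)) expr1n.
  by rewrite [LHS]exprS [RHS]exprS expr_mod.
have w1 : w i ^+ v != 1 by rewrite -(prim_order_dvd (w_prim i)).
have : \sum_j chi j x = w i ^+ v * \sum_j chi j x.
  by rewrite mulr_sumr [LHS](reindex_inj sh_inj); apply: eq_bigr => j _.
move/eqP; rewrite -subr_eq0 -{1}[\sum_j _]mul1r -mulrBl mulf_eq0 subr_eq0 eq_sym (negPf w1).
by move/eqP.
Qed.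

(** The Fourier transform: the linear extension of [chi j] to the group algebra, shown below to be
    an algebra morphism. *)
Definition hat j (u : galg K E) : K := \sum_x u x * chi j x.

(** After exchanging the sums, [sum_chi_dual] at [e^-1 * x] keeps only the term [x = e]. *)
Lemma hat_inversion (u : galg K E) e :
  u e = #|{: E}|%:R^-1 * \sum_j chi j e^-1%g * hat j u.
Proof.
have E0 : #|{: E}|%:R != 0 :> K by rewrite pnatr_eq0 -lt0n; apply/card_gt0P; exists 1%g.
apply: (mulfI E0); rewrite mulrA mulfV // mul1r.
under eq_bigr => j _ do rewrite mulr_sumr.
rewrite exchange_big /= (bigD1 e) //= [X in _ + X]big1 ?addr0 => [|x xe].
  under eq_bigr => j _ do rewrite mulrCA -chiM mulVg chi1 mulr1.
  by rewrite sumr_const (bij_eq_card expoz_bij) mulr_natl.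
under eq_bigr => j _ do rewrite mulrCA -chiM.
rewrite -mulr_sumr sum_chi_dual -eq_mulVg1 eq_sym (negPf xe).
by rewrite !mulr0.
Qed.

Lemma hatD j : {morph hat j : u v / u + v}.
Proof.
by move=> u v; rewrite /hat -big_split; apply: eq_bigr => x _; rewrite ffunE mulrDl.
Qed.

Lemma hatZ j : scalable (hat j : galg K E -> K^o).
Proof.
by move=> a u; rewrite /hat scaler_sumr; apply: eq_bigr => x _; rewrite ffunE -scalerAl.
Qed.

Lemma hat_delta j e : hat j (galg_delta K e) = chi j e.
Proof.
rewrite /hat (bigD1 e) //= ffunE eqxx mul1r big1 ?addr0 // => x /negPf xe.
by rewrite ffunE xe mul0r.
Qed.

Lemma hatM j : {morph hat j : u v / u * v}.
Proof.
move=> u v; rewrite /hat mulr_suml.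
under eq_bigr => g _ do rewrite ffunE mulr_suml.
rewrite exchange_big; apply: eq_bigr => x _.
rewrite mulr_sumr (reindex_inj (mulgI x)); apply: eq_bigr => y _.
by rewrite /= mulKg chiM mulrACA.
Qed.

Lemma hat1 j : hat j 1 = 1.
Proof. by rewrite [1]/(galg_delta K 1%g) hat_delta chi1. Qed.
End Characters.

(** * The numbers N_n and I_d *)

Lemma big_Icount (V : pzSemiRingType) (F : finFieldType) l (G : typeII F l -> V) d :
  \sum_x (Icount d x)%:R * G x = \sum_(p <- irreds F d) G (cls l p).
Proof.
rewrite big_filter /monics big_image_cond /=.
rewrite (partition_big (fun p => cls l (val p)) xpredT) //=; apply: eq_bigr => x _.
rewrite /Icount -sum1_card natr_sum mulr_suml; apply: eq_big => [p|p /[!inE] /and3P[_ _ /eqP->]].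
  by rewrite !inE andbA.
by rewrite mul1r.
Qed.

Lemma big_set_compl1 (V : nmodType) (I : finType) (A : {set I}) i0 (G : I -> V) :
  (forall i, (i \notin A) = (i == i0)) -> \sum_i G i = G i0 + \sum_(i in A) G i.
Proof.
move=> AE; rewrite (bigD1 i0) //=; congr (_ + _); apply: eq_bigl => i.
by rewrite -AE negbK.
Qed.

Section Nseries.
Variables (K : numClosedFieldType) (F : finFieldType) (l f : nat).
Variables (xi : 'I_f -> typeII F l) (r : 'I_f -> nat) (w : 'I_f -> K).
Hypothesis hr : forall i, #[xi i]%g = r i.
Hypothesis hxi : (\big[dprod/1]_(i < f) <[xi i]>)%g = [set: typeII F l].
Hypothesis w_prim : forall i, (r i).-primitive_root (w i).
Hypothesis hl : (0 < l)%N.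
Local Notation E := (typeII F l).
Local Notation chi := (chi xi w).
Local Notation hat := (hat xi w).
Implicit Types (t : 'I_f -> int) (e x y : E) (j : exponents r).

(* For K = R[i] and w i = omega (r i), these are Fseries, Ncoef and Ppoly. *)
Definition Fclass : fps (galg K E) :=
  fun d => \sum_(p in monic_of_degree F d) galg_delta K (cls l (val p)).

Definition Ncls n e : K := n%:R * fps_ln Fclass n e.

Definition Pchi j : {poly K} :=
  1 + \sum_(1 <= k < l.-1.+1) (\sum_(e in classes_of_degree F l k) chi j e) *: 'X^k.

(** The coefficient of [z^d] in the L-series of [chi j]. *)
Definition Lfun j d : K := \sum_(p <- monics F d) chi j (cls l p).

Lemma hat_Fclass j d : hat j (Fclass d) = Lfun j d.
Proof.
have hat0 : hat j (0 : galg K E) = 0.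
  by rewrite /hat big1 // => x _; rewrite ffunE mul0r.
rewrite /Lfun big_monics (big_morph (hat j) (hatD xi w j) hat0).
by apply: eq_bigr => p _; rewrite hat_delta.
Qed.

Lemma Lfun0 j : Lfun j 0 = 1.
Proof. by rewrite /Lfun monics0 big_seq1 cls1 chi1. Qed.

Lemma hat_ln_Fclass j n :
  hat j (fps_ln (Fclass) n) = fps_ln (Lfun j : fps K^o) n.
Proof.
rewrite (@fps_ln_morph _ _ K^o (hat j)); last first.
- exact: hat1.
- exact: hatM.
- exact: hatZ.
- exact: hatD.
exact: (@eq_fps_ln _ K^o _ (Lfun j) n (fun i _ => hat_Fclass j i)).
Qed.

Lemma Ncls_inversion n e :
  Ncls n e = #|{: E}|%:R^-1 *
    \sum_j chi j e^-1%g * (n%:R * fps_ln (Lfun j : fps K^o) n).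
Proof.
under eq_bigr => j _ do rewrite -hat_ln_Fclass mulrCA.
by rewrite -mulr_sumr mulrCA -(hat_inversion hr hxi w_prim).
Qed.

(** Both sides have the same transforms: [log_deriv_monics] computes those of the left, and on the
    right a class [x] is counted at [x ^+ k], where [chi j] takes the value [chi j x ^+ k]. *)
Lemma Ncls_Icount n e : (0 < n)%N ->
  Ncls n e = \sum_(k <- divisors n) (n %/ k)%N%:R *
                  \sum_(x | (x ^+ k)%g == e) (Icount (n %/ k) x)%:R.
Proof.
move=> n0.
pose v : galg K E := [ffun e => \sum_(k <- divisors n) (n %/ k)%N%:R *
                  \sum_(x | (x ^+ k)%g == e) (Icount (n %/ k) x)%:R].
transitivity (v e); last by rewrite ffunE.
rewrite Ncls_inversion (hat_inversion hr hxi w_prim v); congr (_ * _); apply: eq_bigr => j _.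
congr (_ * _); rewrite (log_deriv_ln_uniq _ (Lfun0 j) (@log_deriv_monics _ _ _ _ _)); last first.
- by move=> p q pm qm; rewrite clsM // chiM.
- by rewrite cls1 chi1.
rewrite /hat; under [RHS]eq_bigr => x _ do rewrite ffunE mulr_suml.
rewrite exchange_big /=; apply: eq_bigr => k _.
under [RHS]eq_bigr => x _ do rewrite -mulrA mulr_suml.
rewrite -mulr_sumr; congr (_ * _).
rewrite -(big_Icount (fun x => chi j x ^+ k)).
rewrite [RHS](exchange_big_dep xpredT) //=; apply: eq_bigr => x _.
by rewrite (big_pred1 (x ^+ k)%g) ?chiX // => y; rewrite eq_sym.
Qed.

(** Below degree [l] distinct monic polynomials of one degree have distinct classes, so both
    coefficients agree. From degree [l] on, equidistribution gives a multiple of the full character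
    sum, which is 0. *)
Lemma Lfun_Pchi j d : j \in exponent_J r -> Lfun j d = (Pchi j)`_d.
Proof.
move=> jJ; rewrite /Pchi coefD coef1 coef_sum.
under eq_bigr => k _ do rewrite coefZ coefXn.
case: (posnP d) => [->|d0].
  rewrite Lfun0 /= big_nat big1 ?addr0 // => k /andP[k0 _].
  by rewrite eq_sym gtn_eqF // mulr0.
rewrite add0r prednK //.
have [dl|ld] := ltnP d l.
  rewrite (bigD1_seq d) ?mem_index_iota ?d0 ?iota_uniq //= eqxx mulr1 [X in _ + X]big1 ?addr0.
    by rewrite (big_classes_of_degree _ (ltnW dl)).
  by move=> k /negPf kd; rewrite eq_sym kd mulr0.
rewrite [RHS]big_nat [RHS]big1 => [|k /andP[_ kl]]; last first.
  by rewrite gtn_eqF ?mulr0 // (leq_trans kl).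
by rewrite -(subnKC ld) /Lfun big_cls_monics sum_chi_group ?mul0rn.
Qed.

Lemma chi_notin_J j x : j \notin exponent_J r -> chi j x = 1.
Proof.
rewrite inE negb_exists => /forallP jr; rewrite /chi big1 // => i _.
have /negPn/eqP -> := jr i.
by rewrite mulnC exprM (prim_expr_order (w_prim i)) expr1n.
Qed.

Lemma Lfun_notin_J j d : j \notin exponent_J r -> Lfun j d = #|F|%:R ^+ d.
Proof.
move=> jr; rewrite /Lfun; under eq_bigr => p _ do rewrite (chi_notin_J _ jr).
by rewrite big_const_seq count_predT iter_addr_0 size_monics natrX.
Qed.

Lemma notin_exponent_J : exists j0, forall j, (j \notin exponent_J r) = (j == j0).
Proof.
have r_gt0 i : (0 < r i)%N by rewrite -hr order_gt0.
have lt_r i : ((r i).-1 < r i)%N by rewrite prednK.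
(* The vector of the orders themselves, stored as [(r i).-1] because [expo] adds 1. *)
exists [ffun i => Ordinal (lt_r i)] => j.
rewrite inE negb_exists; apply/forallP/eqP => [jr|-> i].
  apply/ffunP => i; apply: val_inj; rewrite ffunE /=.
  by have /negPn/eqP jri := jr i; rewrite -[in RHS]jri.
by rewrite negbK /expo ffunE /= prednK.
Qed.

(** Fourier inversion with the trivial character, the only index outside [exponent_J r], split off
    as the main term. *)
Lemma Ncls_Pchi n t : (0 < n)%N ->
  Ncls n (gen_prod xi t) =
    #|F|%:R ^ (n%:Z - l%:Z) +
    #|F|%:R ^- l * \sum_(j in exponent_J r)
      (\prod_(i < f) w i ^ (- (expoz j i * t i))) *
      (n%:R * ln_poly (Pchi j) n).
Proof.
move=> n0; have q0 : #|F|%:R != 0 :> K.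
  by rewrite pnatr_eq0 -lt0n; apply/card_gt0P; exists 0.
have [j0 j0E] := notin_exponent_J.
have cardE : #|{: E}|%:R = #|F|%:R ^+ l :> K by rewrite card_typeII natrX.
rewrite Ncls_inversion cardE (big_set_compl1 _ j0E) mulrDr; congr (_ + _); last first.
  congr (_ * _); apply: eq_bigr => j jJ; rewrite (chiV_gen hr hxi w_prim).
  suff -> : fps_ln (Lfun j : fps K^o) n = ln_poly (Pchi j) n by [].
  by apply: (@eq_fps_ln K K^o) => i _; exact: Lfun_Pchi.
have j0J : j0 \notin exponent_J r by rewrite j0E.
rewrite chi_notin_J // mul1r.
(* The trivial character has L-series [1 / (1 - q z)], with [q] for [#|F|], which contributes
   [q ^ n]. *)
rewrite (log_deriv_ln_uniq (g := fun m => (0 < m)%N%:R * #|F|%:R ^+ m)).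
- by rewrite n0 mul1r expfzDr // mulrC -exprnP -exprnN.
- by rewrite Lfun0.
move=> m; have := log_deriv_geom (#|F|%:R : K) m; rewrite Lfun_notin_J // => ->.
by apply: eq_bigr => i _; rewrite Lfun_notin_J.
Qed.
End Nseries.

(** Expanding by [Ncls_Icount], the [m]-th roots of the [k]-th roots of [x] are its [k * m]-th
    roots, so the summand depends on [k * m] only and [sum_moebius] leaves the term [k * m = 1]. *)
Lemma Icount_moebius (K : numClosedFieldType) (F : finFieldType) (l f : nat)
    (xi : 'I_f -> typeII F l) (r : 'I_f -> nat) (w : 'I_f -> K)
    (hr : forall i, #[xi i]%g = r i)
    (hxi : (\big[dprod/1]_(i < f) <[xi i]>)%g = [set: typeII F l])
    (w_prim : forall i, (r i).-primitive_root (w i)) d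
    (x : typeII F l) : (0 < d)%N ->
  d%:R * (Icount d x)%:R = \sum_(k <- divisors d) (moebius k)%:~R *
        \sum_(y | (y ^+ k)%g == x) Ncls K (d %/ k) y.
Proof.
move=> d0; pose G m : K :=
  (d %/ m)%N%:R * \sum_(y | (y ^+ m)%g == x) (Icount (d %/ m) y)%:R.
transitivity (\sum_(k <- divisors d) \sum_(m <- divisors (d %/ k)%N)
    (moebius k)%:~R * G (k * m)%N); last first.
  apply: eq_big_seq => k; rewrite -dvdn_divisors // => kd.
  have dk0 : (0 < d %/ k)%N by rewrite divn_gt0 ?(dvdn_gt0 d0 kd) // dvdn_leq.
  rewrite -mulr_sumr; congr (_ * _).
  under [RHS]eq_bigr => y _ do rewrite (Ncls_Icount hr hxi w_prim) //.
  rewrite exchange_big /=; apply: eq_bigr => m _.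
  rewrite /G -divnMA -mulr_sumr; congr (_ * _).
  rewrite (exchange_big_dep (fun y => (y ^+ (k * m))%g == x)) /=.
    apply: eq_bigr => y yx; rewrite (big_pred1 (y ^+ m)%g) // => z.
    by apply/andP/eqP => [[_ /eqP]|->] //; rewrite -expgM mulnC yx.
  by move=> y z /eqP yx /eqP zy; rewrite mulnC expgM zy yx.
rewrite (exchange_divisors (fun k m => (moebius k)%:~R * G m)) //.
rewrite (bigD1_seq 1%N) ?divisor1 ?divisors_uniq //= big_seq1 [X in _ + X]big_seq_cond.
rewrite big1 ?addr0 => [|m /andP[]].
  by rewrite /moebius /= mul1r /G divn1 (big_pred1 x).
rewrite -dvdn_divisors // => md /negPf m1.
have := sum_moebius (dvdn_gt0 d0 md); rewrite m1 -mulr_suml => sm.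
by rewrite -(big_morph intr (@intrD _) (mulr0z 1)) sm mul0r.
Qed.

Theorem theorem4 (R : realType) (F : finFieldType) (q l f : nat)
    (xi : 'I_f -> typeII F l) (r : 'I_f -> nat)
    (hq : #|F| = q) (hl : (0 < l)%N)
    (hr : forall i, #[xi i]%g = r i)
    (hxi : (\big[dprod/1]_(i < f) <[xi i]>)%g = [set: typeII F l]) :
  (forall (d : nat) (t : 'I_f -> int), (0 < d)%N ->
    (Icount d (gen_prod xi t))%:R =
      d%:R^-1 * \sum_(k <- divisors d) (moebius k)%:~R *
        \sum_(s : exponents r)
          Ncoef R (d %/ k) (gen_prod xi (expoz s)) *
          [forall i, (k%:Z * expoz s i == t i %[mod r i])%Z]%:R :> R[i]) /\
  (forall (n : nat) (t : 'I_f -> int), (0 < n)%N ->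
    Ncoef R n (gen_prod xi t) =
      q%:R ^ (n%:Z - l%:Z) +
      q%:R ^- l * \sum_(j in exponent_J r)
        (\prod_(i < f) omega R (r i) ^ (- (expoz j i * t i))) *
        (n%:R * ln_poly (Ppoly R xi j) n) /\
    Ncoef R n (gen_prod xi t) =
      q%:R ^ (n%:Z - l%:Z) -
      q%:R ^- l * \sum_(j in exponent_J r)
        (\prod_(i < f) omega R (r i) ^ (- (expoz j i * t i))) *
        \sum_(rho <- roots_mult (Ppoly R xi j)) rho ^- n).
Proof.
pose w i := omega R (r i).
have w_prim i : (r i).-primitive_root (w i) by apply: omega_prim; rewrite -hr order_gt0.
have NE n x : Ncoef R n x = Ncls R[i] n x by [].
rewrite -hq; split=> [d t d0|n t n0].
  have dn0 : d%:R != 0 :> R[i] by rewrite pnatr_eq0 -lt0n.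
  apply: (mulfI dn0); rewrite mulrA mulfV // mul1r (Icount_moebius hr hxi w_prim) //.
  apply: eq_bigr => k _; congr (_ * _).
  (* The sum over the [k]-th roots is indexed by exponent vectors, the root condition becoming the
     Iverson bracket. *)
  rewrite (reindex _ (onW_bij _ (expoz_bij hr hxi))) big_mkcond /=; apply: eq_bigr => s _.
  rewrite -gen_prodX (eq_gen_prod hr hxi).
  by case: ifP; rewrite ?mulr1 ?mulr0.
split; first exact: (Ncls_Pchi hr hxi w_prim).
rewrite NE (Ncls_Pchi hr hxi w_prim) // -mulrN -sumrN; congr (_ + _ * _).
apply: eq_bigr => j jJ; rewrite -mulrN; congr (_ * _).
(* The constant term of [Ppoly] is read off as [Lfun j 0 = 1]. *)
by rewrite ln_poly_roots // -(Lfun_Pchi hr hxi w_prim hl) // (Lfun0 hr hxi).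
Qed.
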